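(* (Disjunction property) For any formulas $A$ and $B$, if $\mathsf{iK_d} \vdash A \vee B$ then either $\mathsf{iK_d} \vdash A$ or $\mathsf{iK_d} \vdash B$. The same also holds for $\mathsf{iK_{d*}}$ (with $A$ and $B$ being $\mathcal{L}_*$-formulas).
   Context: Language and sequents. Fix a set $V$ of atomic propositions. $\mathcal{L}$-formulas are built from atoms in $V$ and the constants $\top,\bot$ using binary connectives $\wedge,\vee,\supset,\to$ and the unary connective $\nabla$. $\mathcal{L}_*$-formulas are the $\mathcal{L}$-formulas without $\supset$. ''Formula'' means $\mathcal{L}$-formula unless stated otherwise. $\nabla\Gamma=\{\nabla A \mid A\in\Gamma\}$ as a multiset. A sequent over $\mathfrak{L}\in\{\mathcal{L},\mathcal{L}_*\}$ is an expression $\Gamma\Rightarrow\Delta$ with $\Gamma,\Delta$ finite multisets of $\mathfrak{L}$-formulas, $\Delta$ containing at most one formula. Comma is multiset union; a formula stands for its singleton. Calculus $\mathbf{STL(N,H)}$ (over $\mathcal{L}$). Rules are written ''premises / conclusion''; $\Gamma,\Sigma$ are arbitrary finite multisets, $\Delta$ has at most one formula, $A,B$ are arbitrary formulas. Axioms: $(Id)$ $A\Rightarrow A$; $(L\bot)$ $\bot\Rightarrow$; $(R\top)$ $\Rightarrow\top$. $(Lw)$ $\Gamma\Rightarrow\Delta$ / $\Gamma,A\Rightarrow\Delta$. $(Rw)$ $\Gamma\Rightarrow$ / $\Gamma\Rightarrow A$. $(Lc)$ $\Gamma,A,A\Rightarrow\Delta$ / $\Gamma,A\Rightarrow\Delta$.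 $(cut)$ $\Gamma\Rightarrow A$ and $\Sigma,A\Rightarrow\Delta$ / $\Sigma,\Gamma\Rightarrow\Delta$. $(L\wedge_1)$ $\Gamma,A\Rightarrow\Delta$ / $\Gamma,A\wedge B\Rightarrow\Delta$. $(L\wedge_2)$ $\Gamma,B\Rightarrow\Delta$ / $\Gamma,A\wedge B\Rightarrow\Delta$. $(R\wedge)$ $\Gamma\Rightarrow A$ and $\Gamma\Rightarrow B$ / $\Gamma\Rightarrow A\wedge B$. $(L\vee)$ $\Gamma,A\Rightarrow\Delta$ and $\Gamma,B\Rightarrow\Delta$ / $\Gamma,A\vee B\Rightarrow\Delta$. $(R\vee_1)$ $\Gamma\Rightarrow A$ / $\Gamma\Rightarrow A\vee B$. $(R\vee_2)$ $\Gamma\Rightarrow B$ / $\Gamma\Rightarrow A\vee B$. $(N)$ $\Gamma\Rightarrow\Delta$ / $\nabla\Gamma\Rightarrow\nabla\Delta$. $(L\to)$ $\Gamma\Rightarrow A$ and $\Gamma,B\Rightarrow\Delta$ / $\Gamma,\nabla(A\to B)\Rightarrow\Delta$. $(R\to)$ $\nabla\Gamma,A\Rightarrow B$ / $\Gamma\Rightarrow A\to B$. $(L\supset)$ $\Gamma\Rightarrow A$ and $\Gamma,B\Rightarrow\Delta$ / $\Gamma,A\supset B\Rightarrow\Delta$. $(R\supset)$ $\Gamma,A\Rightarrow B$ / $\Gamma\Rightarrow A\supset B$. $\mathbf{STL(N)}$ is the calculus over $\mathcal{L}_*$ with the same rules except $(L\supset)$ and $(R\supset)$. The logic $\mathsf{iK_d}$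 (resp. $\mathsf{iK_{d*}}$) is the set of $\mathcal{L}$-formulas (resp. $\mathcal{L}_*$-formulas) $A$ such that $\Rightarrow A$ has a proof-tree in $\mathbf{STL(N,H)}$ (resp. $\mathbf{STL(N)}$); $L\vdash A$ means $A\in L$ for these logics $L$. *)

(* Defs.v *)
From Stdlib Require Import List Permutation.
Import ListNotations.

Set Implicit Arguments.

Inductive formula (V : Type) : Type :=
| Atom (p : V)
| Top
| Bot
| And (A B : formula V)
| Or (A B : formula V)
| Imp (A B : formula V)  (* the Heyting implication [⊃] *)
| Arr (A B : formula V)  (* the implication [→] *)
| Nabla (A : formula V).

Arguments Top {V}.
Arguments Bot {V}.

Fixpoint Lstar (V : Type) (A : formula V) : Prop :=
  match A with
  | Atom _ | Top | Bot => True
  | And A B | Or A B | Arr A B => Lstar A /\ Lstar B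
  | Nabla A => Lstar A
  | Imp _ _ => False
  end.

Definition Lfull (V : Type) (A : formula V) : Prop := True.

(* The antecedent, a finite multiset, is represented by a list; lists that are
   permutations of each other are identified by the rule [Exchange] below.
   The succedent has at most one formula. *)
Record sequent (V : Type) : Type := Sequent {
  antecedent : list (formula V);
  succedent : option (formula V)
}.

Notation "G ⇒ D" := (Sequent G D) (at level 70, no associativity).

Definition sequent_over (V : Type) (F : formula V -> Prop) (s : sequent V) :
    Prop :=
  (forall A, In A (antecedent s) -> F A) /\
  (forall A, succedent s = Some A -> F A).

(* [R ps c]: the sequent [c] follows from the list of premises [ps]. *)
Definition rules (V : Type) : Type := list (sequent V) -> sequent V -> Prop.

Inductive rules_N (V : Type) : rules V :=
| Exchange G G' D : Permutation G G' ->
    rules_N [G ⇒ D] (G' ⇒ D)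
| Id A :
    rules_N [] ([A] ⇒ Some A)
| LBot :
    rules_N [] ([Bot] ⇒ None)
| RTop :
    rules_N [] ([] ⇒ Some Top)
| Lw G A D :
    rules_N [G ⇒ D] (A :: G ⇒ D)
| Rw G A :
    rules_N [G ⇒ None] (G ⇒ Some A)
| Lc G A D :
    rules_N [A :: A :: G ⇒ D] (A :: G ⇒ D)
| Cut G S A D :
    rules_N [G ⇒ Some A; A :: S ⇒ D] (S ++ G ⇒ D)
| LAnd1 G A B D :
    rules_N [A :: G ⇒ D] (And A B :: G ⇒ D)
| LAnd2 G A B D :
    rules_N [B :: G ⇒ D] (And A B :: G ⇒ D)
| RAnd G A B :
    rules_N [G ⇒ Some A; G ⇒ Some B] (G ⇒ Some (And A B))
| LOr G A B D :
    rules_N [A :: G ⇒ D; B :: G ⇒ D] (Or A B :: G ⇒ D)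
| ROr1 G A B :
    rules_N [G ⇒ Some A] (G ⇒ Some (Or A B))
| ROr2 G A B :
    rules_N [G ⇒ Some B] (G ⇒ Some (Or A B))
| RuleN G D :
    rules_N [G ⇒ D] (map (@Nabla V) G ⇒ option_map (@Nabla V) D)
| LArr G A B D :
    rules_N [G ⇒ Some A; B :: G ⇒ D] (Nabla (Arr A B) :: G ⇒ D)
| RArr G A B :
    rules_N [A :: map (@Nabla V) G ⇒ Some B] (G ⇒ Some (Arr A B)).

Inductive rules_NH (V : Type) : rules V :=
| NH_N ps c : rules_N ps c -> rules_NH ps c
| LImp G A B D :
    rules_NH [G ⇒ Some A; B :: G ⇒ D] (Imp A B :: G ⇒ D)
| RImp G A B :
    rules_NH [A :: G ⇒ Some B] (G ⇒ Some (Imp A B)).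

(* There is a proof-tree of the sequent, by the rules [R], in which every
   sequent consists of formulas of the language [F]. *)
Inductive provable (V : Type) (F : formula V -> Prop) (R : rules V) :
    sequent V -> Prop :=
| Provable ps c : sequent_over F c -> R ps c ->
    (forall p, In p ps -> provable F R p) -> provable F R c.

Definition STL_NH (V : Type) : sequent V -> Prop :=
  provable (@Lfull V) (@rules_NH V).

Definition STL_N (V : Type) : sequent V -> Prop :=
  provable (@Lstar V) (@rules_N V).

Definition iKd (V : Type) (A : formula V) : Prop :=
  Lfull A /\ STL_NH ([] ⇒ Some A).

Definition iKd_star (V : Type) (A : formula V) : Prop :=
  Lstar A /\ STL_N ([] ⇒ Some A).

(* Main.v *)
Require Import Defs.
From Stdlib Require Import List Permutation.
Import ListNotations.

(** The proof is a slash argument in the style of Kleene and Aczel.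

    A predicate [slash] on formulas is defined by recursion so that a slashed
    formula is a theorem, and a slashed disjunction has a slashed disjunct.
    It then suffices that every theorem is slashed, which is the case of an
    empty antecedent in [slash_sound]: a provable sequent with a slashed
    antecedent has a slashed succedent.

    Semantically, the calculi describe intuitionistic Kripke models with a
    monotone map [π] on worlds, where [∇ A] holds at [w] when [A] holds at
    [π w], and [A → B] holds at [w] when [A] implies [B] at every [v] with
    [w ≤ π v].  The slash is truth at a new root placed below the canonical
    model and fixed by [π].  As the root is fixed, [∇ A] is slashed when [A]
    is.  As every world [v] satisfies [root ≤ π v], the formula [A → B] is
    slashed when [A] implies [B] in all the old worlds, that is, when [A → B]
    is a theorem, and in the root itself.  So both implications get the same
    clause.

    Since [Cut] is a rule, provability of a succedent whose antecedent
    consists of theorems is immediate ([cut_theorems]), and only the recursive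
    part of the slash has to be followed through the rules.  No step builds a
    formula outside the given proof-tree, so the argument is uniform in the
    language, and treats the calculi with and without [⊃] at once. *)

(** Provability is required in every clause, not only for atoms and
    implications, so that a slashed formula is a theorem without any closure
    property of the language [F]. *)
Fixpoint slash {V : Type} (F : formula V -> Prop) (R : rules V)
    (A : formula V) : Prop :=
  provable F R ([] ⇒ Some A) /\
  match A with
  | Atom _ | Top => True
  | Bot => False
  | And A B => slash F R A /\ slash F R B
  | Or A B => slash F R A \/ slash F R B
  | Imp A B | Arr A B => slash F R A -> slash F R B
  | Nabla A => slash F R A
  end.

Definition slash_succedent {V : Type} (F : formula V -> Prop) (R : rules V)
    (D : option (formula V)) : Prop :=
  match D with
  | Some A => slash F R A
  | None => False
  end.

Lemma slash_provable {V : Type} (F : formula V -> Prop) (R : rules V)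
    (A : formula V) :
  slash F R A -> provable F R ([] ⇒ Some A).
Proof. destruct A; intros [H _]; exact H. Qed.

Lemma provable_over {V : Type} (F : formula V -> Prop) (R : rules V)
    (s : sequent V) :
  provable F R s -> sequent_over F s.
Proof. destruct 1; assumption. Qed.

Lemma cut_theorems {V : Type} (F : formula V -> Prop) (R : rules V)
    (HR : forall ps c, rules_N ps c -> R ps c)
    (G : list (formula V)) (D : option (formula V)) :
  provable F R (G ⇒ D) ->
  (forall A, In A G -> provable F R ([] ⇒ Some A)) ->
  provable F R ([] ⇒ D).
Proof.
  induction G as [|A G IH]; intros HGD HG; [exact HGD|].
  apply IH; [|intros C HC; apply HG; now right].
  pose proof (Cut [] G A D) as HCut.
  rewrite app_nil_r in HCut.
  apply (Provable [[] ⇒ Some A; A :: G ⇒ D]).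
  - destruct (provable_over F R _ HGD) as [HA HD].
    split; [|exact HD].
    intros C HC; apply HA; now right.
  - exact (HR _ _ HCut).
  - intros p [<-|[<-|[]]]; [apply HG; now left|exact HGD].
Qed.

(** This is where the new root being fixed by [π] is used: theorems are closed
    under [∇] by [RuleN], and the recursive clause is the hypothesis. *)
Lemma slash_Nabla {V : Type} (F : formula V -> Prop) (R : rules V)
    (HR : forall ps c, rules_N ps c -> R ps c) (A : formula V) :
  F (Nabla A) -> slash F R A -> slash F R (Nabla A).
Proof.
  intros HF HA; split; [|exact HA].
  apply Provable with (ps := [[] ⇒ Some A]).
  - split; simpl; [intros C []|now intros C [= <-]].
  - apply HR, (RuleN [] (Some A)).
  - intros p [<-|[]]; now apply slash_provable.
Qed.

(** By [cut_theorems], a compound succedent is a theorem at once, so each right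
    rule only owes the recursive clause, which its premises give.  In the rule
    [RArr], the premise has the antecedent [∇ G], slashed by [slash_Nabla]; in
    [LArr], a slashed [∇ (A → B)] contains the slashed [A → B] and therefore
    acts as [A ⊃ B] does in [LImp]. *)
Lemma slash_sound {V : Type} (F : formula V -> Prop) (R : rules V)
    (HR : forall ps c, rules_N ps c -> R ps c)
    (HR' : forall ps c, R ps c -> rules_NH ps c) (s : sequent V) :
  provable F R s ->
  (forall A, In A (antecedent s) -> slash F R A) ->
  slash_succedent F R (succedent s).
Proof.
  induction 1 as [ps c Hc Hr Hps IH]; intros HG.
  assert (Hthm : provable F R ([] ⇒ succedent c)).
  { apply (cut_theorems F R HR (antecedent c)).
    - destruct c; exact (Provable _ Hc Hr Hps).
    - intros A HA; now apply slash_provable, HG. }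
  apply HR' in Hr.
  destruct Hr as [ps c Hr|G A B D|G A B];
    [destruct Hr as [G G' D HP|A| | |G A D|G A|G A D|G S A D|G A B D|G A B D
      |G A B|G A B D|G A B|G A B|G D|G A B D|G A B]| |];
    cbn [antecedent succedent] in *.
  - apply (IH (G ⇒ D)); [now left|].
    intros C HC; apply HG; now apply (Permutation_in C HP).
  - apply HG; now left.
  - now destruct (HG Bot (or_introl eq_refl)).
  - now split.
  - apply (IH (G ⇒ D)); [now left|].
    intros C HC; apply HG; now right.
  - destruct (IH (G ⇒ None)); [now left|exact HG].
  - apply (IH (A :: A :: G ⇒ D)); [now left|].
    intros C [<-|HC]; apply HG; [now left|exact HC].
  - apply (IH (A :: S ⇒ D)); [now right; left|].
    intros C [<-|HC]; [|apply HG, in_or_app; now left].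
    apply (IH (G ⇒ Some A)); [now left|].
    intros C HC; apply HG, in_or_app; now right.
  - apply (IH (A :: G ⇒ D)); [now left|].
    intros C [<-|HC]; [|apply HG; now right].
    now destruct (HG (And A B) (or_introl eq_refl)) as [_ []].
  - apply (IH (B :: G ⇒ D)); [now left|].
    intros C [<-|HC]; [|apply HG; now right].
    now destruct (HG (And A B) (or_introl eq_refl)) as [_ []].
  - split; [exact Hthm|split].
    + apply (IH (G ⇒ Some A)); [now left|exact HG].
    + apply (IH (G ⇒ Some B)); [now right; left|exact HG].
  - destruct (HG (Or A B) (or_introl eq_refl)) as [_ [HA|HB]].
    + apply (IH (A :: G ⇒ D)); [now left|].
      intros C [<-|HC]; [exact HA|apply HG; now right].
    + apply (IH (B :: G ⇒ D)); [now right; left|].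
      intros C [<-|HC]; [exact HB|apply HG; now right].
  - split; [exact Hthm|left].
    apply (IH (G ⇒ Some A)); [now left|exact HG].
  - split; [exact Hthm|right].
    apply (IH (G ⇒ Some B)); [now left|exact HG].
  - assert (HD : slash_succedent F R D).
    { apply (IH (G ⇒ D)); [now left|].
      intros C HC; now destruct (HG (Nabla C) (in_map _ _ _ HC)). }
    destruct D as [A|]; [split; [exact Hthm|exact HD]|exact HD].
  - destruct (HG (Nabla (Arr A B)) (or_introl eq_refl)) as [_ [_ HAB]].
    assert (HG' : forall C, In C G -> slash F R C)
      by (intros C HC; apply HG; now right).
    apply (IH (B :: G ⇒ D)); [now right; left|].
    intros C [<-|HC]; [|now apply HG'].
    apply HAB, (IH (G ⇒ Some A)); [now left|exact HG'].
  - split; [exact Hthm|intros HA].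
    apply (IH (A :: map (@Nabla V) G ⇒ Some B)); [now left|].
    intros C [<-|HC]; [exact HA|].
    pose proof HC as HC'.
    apply in_map_iff in HC as [C' [<- HC]].
    apply slash_Nabla; [exact HR| |now apply HG].
    (* [Nabla C'] is in the language because it occurs in the premise. *)
    destruct (provable_over F R _ (Hps _ (or_introl eq_refl))) as [Hover _].
    apply Hover; now right.
  - destruct (HG (Imp A B) (or_introl eq_refl)) as [_ HAB].
    assert (HG' : forall C, In C G -> slash F R C)
      by (intros C HC; apply HG; now right).
    apply (IH (B :: G ⇒ D)); [now right; left|].
    intros C [<-|HC]; [|now apply HG'].
    apply HAB, (IH (G ⇒ Some A)); [now left|exact HG'].
  - split; [exact Hthm|intros HA].
    apply (IH (A :: G ⇒ Some B)); [now left|].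
    intros C [<-|HC]; [exact HA|now apply HG].
Qed.

Lemma disjunction_property {V : Type} (F : formula V -> Prop) (R : rules V)
    (HR : forall ps c, rules_N ps c -> R ps c)
    (HR' : forall ps c, R ps c -> rules_NH ps c) (A B : formula V) :
  provable F R ([] ⇒ Some (Or A B)) ->
  provable F R ([] ⇒ Some A) \/ provable F R ([] ⇒ Some B).
Proof.
  intros H.
  apply (slash_sound F R HR HR') in H; [|intros C []].
  destruct H as [_ [H|H]]; [left|right]; now apply slash_provable.
Qed.

Theorem theorem14 (V : Type) :
  (forall A B : formula V, iKd (Or A B) -> iKd A \/ iKd B) /\
  (forall A B : formula V, Lstar A -> Lstar B ->
     iKd_star (Or A B) -> iKd_star A \/ iKd_star B).
Proof.
  split.
  - intros A B [_ H].
    destruct (disjunction_property (@Lfull V) (@rules_NH V) (@NH_N V)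
      (fun _ _ h => h) A B H); [left|right]; now split.
  - intros A B HA HB [_ H].
    destruct (disjunction_property (@Lstar V) (@rules_N V) (fun _ _ h => h)
      (@NH_N V) A B H); [left|right]; now split.
Qed.
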